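(* Let $G$ be a finite simple graph on $n \ge 2$ nodes with $m$ edges and algebraic connectivity $\lambda_2$, and let $\ell \ge 1$ be an integer. Let $s_\ell$ denote the number of nodes of $G$ of eccentricity at most $\ell$, and let $e(G^\ell)$ denote the number of edges of the $\ell$-th power $G^\ell$ of $G$. Then $$\lambda_{2} \ge \frac{s_\ell}{1+\ell\left(e(G^{\ell})-m\right)}.$$
   Context: The distance between two nodes of $G$ is the number of edges in a shortest path joining them, and is $\infty$ if there is no such path. The eccentricity of a node is the maximum of its distances to the nodes of $G$ (so it is $\infty$ for every node if $G$ is disconnected, in which case $s_\ell=0$). The $\ell$-th power $G^\ell$ is the simple graph with the same node set as $G$ in which two distinct nodes are adjacent if and only if their distance in $G$ is at most $\ell$. The Laplacian matrix of $G$ is $L(G)=D-A$, where $A$ is the adjacency matrix and $D$ is the diagonal matrix with $D(i,i)=\sum_j A(i,j)$. The algebraic connectivity $\lambda_2$ is the second smallest eigenvalue of $L(G)$, eigenvalues being counted with multiplicity (the smallest eigenvalue is $0$). *)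

(* Defs.v *)
From mathcomp Require Import all_boot all_order all_algebra.
From mathcomp Require Import polyrcf.

Set Implicit Arguments.
Unset Strict Implicit.
Unset Printing Implicit Defensive.

Import Order.TTheory GRing.Theory Num.Theory.

Record sgraph (T : finType) := SGraph {
  adj :> rel T;
  adj_sym : symmetric adj;
  adj_irr : irreflexive adj
}.

(* Extended naturals: [None] is infinity. *)
Definition enat := option nat.

Definition emax (a b : enat) : enat :=
  if a is Some m then if b is Some n then Some (maxn m n) else None else None.

Definition ele (a : enat) (l : nat) : bool :=
  if a is Some m then m <= l else false.

Section Graph.
Variables (T : finType) (G : sgraph T).

Definition edges : {set {set T}} := [set [set p.1; p.2] | p : T * T & G p.1 p.2].

(* There is a path with [k] edges, hence [k.+1] distinct nodes, from [x] to [y]. *)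
Definition has_path (x y : T) (k : nat) : bool :=
  [exists p : k.-tuple T, [&& path G x p, last x p == y & uniq (x :: p)]].

(* The nodes of a path are distinct, so the range below misses no path length. *)
Definition dist (x y : T) : enat := ohead [seq k <- iota 0 #|T| | has_path x y k].

Definition ecc (x : T) : enat := \big[emax/Some 0]_(y : T) dist x y.

Definition num_ecc_le (l : nat) : nat := #|[set x | ele (ecc x) l]|.

Lemma has_path_sym x y k : has_path x y k = has_path y x k.
Proof.
suff H u v : has_path u v k -> has_path v u k by apply/idP/idP; apply: H.
case/existsP=> p /and3P[pP /eqP lP uP].
have sz : size (rev (belast u p)) == k by rewrite size_rev size_belast size_tuple.
have E : v :: rev (belast u p) = rev (u :: p) by rewrite [u :: _]lastI rev_rcons lP.
apply/existsP; exists (Tuple sz) => /=; apply/and3P; split.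
- rewrite -lP rev_path; apply: sub_path pP => a b ab.
  by rewrite adj_sym.
- by rewrite -(last_cons v) E rev_cons last_rcons.
- by rewrite -cons_uniq E rev_uniq.
Qed.

Lemma dist_sym x y : dist x y = dist y x.
Proof. by rewrite /dist; congr ohead; apply: eq_filter => k; apply: has_path_sym. Qed.

Definition power_adj (l : nat) : rel T := fun x y => (x != y) && ele (dist x y) l.

Lemma power_adj_sym l : symmetric (power_adj l).
Proof. by move=> x y; rewrite /power_adj eq_sym dist_sym. Qed.

Lemma power_adj_irr l : irreflexive (power_adj l).
Proof. by move=> x; rewrite /power_adj eqxx. Qed.

Definition power (l : nat) : sgraph T := SGraph (power_adj_sym l) (power_adj_irr l).

End Graph.

Local Open Scope ring_scope.

Section Spectrum.
Variable R : rcfType.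

Definition adjmx (T : finType) (G : sgraph T) : 'M[R]_#|T| :=
  \matrix_(i, j) (G (enum_val i) (enum_val j))%:R.

Definition degmx (T : finType) (G : sgraph T) : 'M[R]_#|T| :=
  diag_mx (\row_i \sum_j adjmx G i j).

Definition laplacian (T : finType) (G : sgraph T) : 'M[R]_#|T| :=
  degmx G - adjmx G.

(* The eigenvalues of [A] in [R], in nondecreasing order, each repeated
   according to its multiplicity as a root of the characteristic polynomial. *)
Definition eigenvalues (n : nat) (A : 'M[R]_n) : seq R :=
  sort <=%R (flatten [seq nseq (mup x (char_poly A)) x | x <- rootsR (char_poly A)]).

(* Indices start at 0, so this is the second smallest eigenvalue. *)
Definition algebraic_connectivity (T : finType) (G : sgraph T) : R :=
  (eigenvalues (laplacian G))`_1.

End Spectrum.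

(* Main.v *)
Require Import Defs.
From mathcomp Require Import all_boot all_order all_algebra.
From mathcomp Require Import perm complex polyrcf ring lra.
Import Order.TTheory GRing.Theory Num.Theory.
Local Open Scope ring_scope.

Set Implicit Arguments.
Unset Strict Implicit.
Unset Printing Implicit Defensive.

(** For a function [f] on the nodes, let [energy G f] be the sum of
    [(f u - f v)^2] over the ordered pairs of adjacent nodes; it is twice the
    quadratic form of the Laplacian. Let [Q] be the sum of the [(f u)^2]. The
    energy of [f] on the power [G^l] is compared with [Q] from below and with the
    energy on [G] from above, where [f] is an eigenvector of the Laplacian for
    the algebraic connectivity that is orthogonal to the constants, so that
    [energy G f] is twice [lambda_2 Q].

    From below ([energy_dominating_ge]): a node of eccentricity at most [l] is
    adjacent to all the others in [G^l]. Since [f] has zero sum, all ordered pairs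
    of nodes together contribute [2 n Q], and the pairs that avoid the [s] nodes of
    small eccentricity contribute at most [2 (n - s) Q]; what remains is at least
    [2 s Q].

    From above ([energy_power_le]): an edge of [G^l] that is not an edge of [G]
    joins two nodes linked by a path with at most [l] edges, and by the
    Cauchy-Schwarz inequality [(f x - f y)^2] is at most [l] times the sum of the
    squared increments along that path, that is, at most half of
    [l * energy G f] ([sqr_dist_le]). There are [e(G^l) - m] such edges, each
    giving two ordered pairs.

    Combining both bounds, [2 s Q <= 2 lambda_2 Q (1 + l (e(G^l) - m))].

    The eigenvector exists by the spectral theorem for real symmetric matrices
    ([symmetric_diagonalizable]), which also shows that the list of eigenvalues
    read off the characteristic polynomial is the diagonal of a diagonalization
    ([perm_eigenvalues]). *)

(** * Eigenvalues of real symmetric matrices *)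

(** Over the complex numbers [R[i]] the matrix is Hermitian, hence unitarily
    similar to a diagonal matrix with real entries; two real matrices that are
    similar over [R[i]] are similar over [R]. *)
Lemma symmetric_diagonalizable (R : rcfType) n (A : 'M[R]_n) : A^T = A ->
  exists P : 'M[R]_n, exists2 d : 'rV[R]_n, P \in unitmx & P *m A = diag_mx d *m P.
Proof.
move=> symA; pose toC : {rmorphism R -> R[i]%C} := real_complex R.
have realP p q (M : 'M[R[i]%C]_(p, q)) : M \is a mxOver Num.real ->
    M = map_mx toC (map_mx (@complex.Re R) M).
  move=> /mxOverP realM; apply/matrixP=> i j; rewrite !mxE.
  by rewrite /= RRe_real.
have AC_real : map_mx toC A \is a mxOver Num.real.
  by apply/mxOverP=> i j; rewrite mxE complex_real.
have AC_herm : map_mx toC A \is hermsymmx.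
  apply: realsym_hermsym => //; apply/is_hermitianmxP.
  by rewrite expr0 scale1r map_mx_id // map_trmx symA.
pose d := spectral_diag (map_mx toC A).
have d_real : d \is a mxOver Num.real by apply: hermitian_spectral_diag_real.
have D_real : diag_mx d \is a mxOver Num.real.
  apply/mxOverP=> i j; rewrite mxE rpredMn //; exact: (mxOverP d_real).
have [|//|//|P] := @real_similar _ _ (map_mx toC A) (diag_mx d).
  exists (spectralmx (map_mx toC A)); first exact: spectral_unit.
  apply/similarP; first exact: spectral_unit.
  have /orthomx_spectralP {2}-> := hermitian_normalmx AC_herm.
  by rewrite !mulmxA mulmxV ?spectral_unit // mul1mx.
rewrite inE => /andP[P_real P_unit] /(similarP P_unit).
exists (map_mx (@complex.Re R) P), (map_mx (@complex.Re R) d).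
  by rewrite -(map_unitmx toC) -realP.
apply: (map_mx_inj (f:=toC)); rewrite !map_mxM -realP //.
by rewrite map_diag_mx -realP.
Qed.

(** The characteristic polynomial of [A] is the product of the ['X - d_i], so
    each [x] has as multiplicity its number of occurrences among the [d_i]. *)
Lemma perm_eigenvalues (R : rcfType) n (A P : 'M[R]_n) (d : 'rV[R]_n) :
  P \in unitmx -> P *m A = diag_mx d *m P ->
  perm_eq (eigenvalues A) [tuple d 0 i | i < n].
Proof.
move=> P_unit PA; pose CP := map_mx polyC P.
have PE : CP *m char_poly_mx A = char_poly_mx (diag_mx d) *m CP.
  rewrite /char_poly_mx mulmxBr mulmxBl -!map_mxM PA; congr (_ - _).
  by rewrite scalar_mxC.
have CP_neq0 : \det CP != 0.
  by rewrite det_map_mx polyC_eq0 -unitfE -unitmxE.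
have chiA : char_poly A = \prod_(x <- [tuple d 0 i | i < n]) ('X - x%:P).
  apply: (mulfI CP_neq0); rewrite -det_mulmx PE det_mulmx mulrC.
  congr (_ * _); rewrite -/(char_poly _) char_poly_trig; last first.
    exact/is_diag_mx_is_trig/diag_mx_is_diag.
  by rewrite big_map big_enum; apply: eq_bigr => i _; rewrite mxE eqxx.
have chi_neq0 : char_poly A != 0 by rewrite monic_neq0 ?char_poly_monic.
set s := tval _ in chiA *; rewrite /eigenvalues perm_sort.
under eq_map => x do rewrite chiA mu_prod_XsubC.
apply: perm_trans (perm_count_undup s).
apply/perm_flatten/perm_map/uniq_perm; rewrite ?undup_uniq ?uniq_roots // => x.
have := roots_on_rootsR chi_neq0 x; rewrite in_itv /= => <-.
by rewrite chiA root_prod_XsubC mem_undup.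
Qed.

(** If the second eigenvalue is not zero, its eigenvectors are automatically
    orthogonal to the kernel vector of ones. If it is zero, then so is the first
    one, because [A] is positive semidefinite; the kernel then contains two
    independent vectors, and some combination of them is orthogonal to the
    vector of ones. *)
Lemma second_eigenvector (R : rcfType) n (A : 'M[R]_n) : (2 <= n)%N ->
    A^T = A -> (forall v : 'rV_n, 0 <= (v *m A *m v^T) 0 0) ->
    A *m const_mx 1 = 0 :> 'cV_n ->
  exists2 v : 'rV_n, v != 0 &
    v *m A = (eigenvalues A)`_1 *: v /\ v *m const_mx 1 = 0 :> 'cV_1.
Proof.
move=> n_ge2 symA psdA A1; have [P [d P_unit PA]] := symmetric_diagonalizable symA.
have eigP i : row i P *m A = d 0 i *: row i P.
  by rewrite -row_mul PA row_mul row_diag_mx -scalemxAl -rowE.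
have comb_neq0 (c : 'rV_n) : c != 0 -> c *m P != 0.
  by apply: contra_neq => cP0; rewrite -[c](mulmxK P_unit) cP0 mul0mx.
have rowP_neq0 i : row i P != 0.
  rewrite rowE comb_neq0 //; apply/eqP => /rowP /(_ i); rewrite !mxE !eqxx.
  exact/eqP/oner_neq0.
have d_ge0 i : 0 <= d 0 i.
  have := psdA (row i P); rewrite eigP -scalemxAl mxE pmulr_lge0 //.
  rewrite lt_neqAle eq_sym; apply/andP; split; last first.
    by rewrite mxE sumr_ge0 // => j _; rewrite !mxE -expr2 sqr_ge0.
  apply: contra_neq (rowP_neq0 i) => /eqP; rewrite mxE psumr_eq0; last first.
    by move=> j _; rewrite !mxE -expr2 sqr_ge0.
  move/allP=> vv0; apply/rowP => j; have := vv0 j; rewrite mem_index_enum.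
  by move=> /(_ isT) /=; rewrite !mxE -expr2 sqrf_eq0 => /eqP.
have /tuple_permP [s Es] := perm_eigenvalues P_unit PA.
have n_gt0 : (0 < n)%N by apply: leq_trans n_ge2.
pose i0 := Ordinal n_gt0; pose i1 := Ordinal n_ge2.
have nthE (i : 'I_n) : (eigenvalues A)`_i = d 0 (s i).
  rewrite Es -(tnth_nth 0 [tuple tnth [tuple d 0 i | i < n] (s i) | i < n] i).
  by rewrite !tnth_mktuple.
have [e0 e1] : (eigenvalues A)`_0 = d 0 (s i0) /\ (eigenvalues A)`_1 = d 0 (s i1).
  by split; [exact: (nthE i0) | exact: (nthE i1)].
have le01 : (eigenvalues A)`_0 <= (eigenvalues A)`_1.
  apply: (le_sorted_leq_nth 0); rewrite ?inE ?Es ?size_tuple //.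
  by rewrite -Es; apply: sort_le_sorted.
rewrite e1; have [d1|d1] := eqVneq (d 0 (s i1)) 0; last first.
  exists (row (s i1) P); rewrite ?rowP_neq0 //; split => //.
  apply: (scalerI d1); rewrite scaler0 scalemxAl -eigP -mulmxA A1.
  by rewrite mulmx0.
have d0 : d 0 (s i0) = 0.
  by apply/eqP; rewrite eq_le d_ge0 andbT; move: le01; rewrite e0 e1 d1.
pose t i := (row i P *m const_mx 1 : 'cV_1) 0 0.
have [t1|t1] := eqVneq (t (s i1)) 0.
  exists (row (s i1) P); rewrite ?rowP_neq0 //; split => //.
  by apply/rowP => k; rewrite ord1 -/(t _) t1 mxE.
(* c P is the combination of the two kernel rows whose entries sum to zero. *)
pose c : 'rV[R]_n := delta_mx 0 (s i0) - (t (s i0) / t (s i1)) *: delta_mx 0 (s i1).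
have cPE : c *m P = row (s i0) P - (t (s i0) / t (s i1)) *: row (s i1) P.
  by rewrite mulmxBl -scalemxAl -!rowE.
exists (c *m P); last first.
  rewrite d1 scale0r cPE !mulmxBl -!scalemxAl !eigP d0 d1 !scale0r scaler0 subr0.
  split=> //; apply/rowP => k; rewrite ord1 mxE -/(t _) 2!mxE -/(t _) mxE.
  by rewrite mulfVK // subrr.
apply: comb_neq0; apply/eqP => /rowP /(_ (s i0)); rewrite !mxE !eqxx /=.
rewrite (inj_eq perm_inj) -val_eqE /= mulr0 subr0.
exact/eqP/oner_neq0.
Qed.

(** * Edges, eccentricities and powers *)

(** The edge [{a, b}] comes from exactly the two ordered pairs [(a, b)] and
    [(b, a)]. *)
Lemma card_adj_pairs (T : finType) (G : sgraph T) :
  #|[set p : T * T | G p.1 p.2]| = (2 * #|edges G|)%N.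
Proof.
rewrite -sum1_card (partition_big_imset (fun p : T * T => [set p.1; p.2])) /=.
have -> : [set [set p.1; p.2] | p in [set p : T * T | G p.1 p.2]] = edges G.
  by apply/setP=> e; apply/imsetP/imsetP => -[p] Gp ->; exists p; rewrite inE in Gp *.
rewrite mulnC -sum_nat_const; apply: eq_bigr => e /imsetP[[a b]].
rewrite inE /= => ab ->; have aNb : a != b by apply: contraTneq ab => ->; rewrite adj_irr.
rewrite sum1_card -(_ : #|[set (a, b); (b, a)]| = 2%N); last first.
  by rewrite cards2 xpair_eqE negb_and aNb.
apply: eq_card => -[u v]; rewrite !inE /= !xpair_eqE; apply/andP/orP.
  case=> uv /eqP/setP E; have uNv : u != v.
    by apply: contraTneq uv => ->; rewrite inE adj_irr.
  move: (E u) (E v) uNv; rewrite !inE !eqxx orbT /=.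
  move=> /esym/orP[]/eqP-> /esym/orP[]/eqP->; rewrite !eqxx //; by [left|right].
case=> /andP[/eqP-> /eqP->]; first by rewrite inE ab eqxx.
by rewrite inE adj_sym ab setUC eqxx.
Qed.

Lemma ele_ecc (T : finType) (G : sgraph T) l x y :
  ele (ecc G x) l -> ele (dist G x y) l.
Proof.
have ele_max a b : ele (emax a b) l = ele a l && ele b l.
  by case: a b => [a|] [b|] //=; rewrite ?geq_max ?andbF.
rewrite /ecc; have : y \in index_enum T by rewrite mem_index_enum.
elim: (index_enum T) => // z r IHr; rewrite big_cons ele_max in_cons.
by case/orP=> [/eqP->|/IHr ry] /andP[] // _.
Qed.

Lemma adj_power (T : finType) (G : sgraph T) l x y :
  (1 <= l)%N -> G x y -> power G l x y.
Proof.
move=> l_ge1 xy; have xNy : x != y by apply: contraTneq xy => ->; rewrite adj_irr.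
rewrite /= /power_adj xNy /=.
have T_ge2 : (2 <= #|T|)%N.
  by have := max_card [set x; y]; rewrite cards2 xNy.
have xy1 : has_path G x y 1.
  by apply/existsP; exists [tuple y]; rewrite /= xy eqxx inE xNy.
rewrite /dist -(subnKC T_ge2) /= xy1.
by case: (has_path G x y 0).
Qed.

Lemma card_edges_power (T : finType) (G : sgraph T) l : (1 <= l)%N ->
  (#|edges G| <= #|edges (power G l)|)%N.
Proof.
move=> l_ge1; rewrite -(leq_pmul2l (isT : 0 < 2)%N) -!card_adj_pairs.
by apply: subset_leq_card; apply/subsetP => p; rewrite !inE; apply: adj_power.
Qed.

(** * The energy of a function on the nodes *)

Section Energy.
Variables (R : realFieldType) (T : finType).
Implicit Types (G H : sgraph T) (f : T -> R).

(** The sum runs over ordered pairs, so that it is a double sum over the nodes;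
    each edge is counted once for each orientation. *)
Definition energy G f : R := \sum_u \sum_v (G u v)%:R * (f u - f v) ^+ 2.

Lemma energy_ge0 G f : 0 <= energy G f.
Proof. by do 2!apply: sumr_ge0 => ? _; rewrite mulr_ge0 ?ler0n ?sqr_ge0. Qed.

Lemma sum_adj G : \sum_u \sum_v (G u v)%:R = 2 * #|edges G|%:R :> R.
Proof.
rewrite -natrM -card_adj_pairs -sum1_card natr_sum pair_big /= [RHS]big_mkcond.
by apply: eq_bigr => p _; rewrite inE; case: (G _ _).
Qed.

Fixpoint path_energy f x p : R :=
  if p is y :: p' then (f x - f y) ^+ 2 + path_energy f y p' else 0.

Lemma path_energy_ge0 f x p : 0 <= path_energy f x p.
Proof. by elim: p x => //= y p IHp x; rewrite addr_ge0 ?sqr_ge0. Qed.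

(** This is the Cauchy-Schwarz inequality for the telescoping sum of the
    increments of [f] along the path. *)
Lemma sqr_path_le f x p :
  (f x - f (last x p)) ^+ 2 <= (size p)%:R * path_energy f x p.
Proof.
elim: p x => [|y p IHp] x /=; first by rewrite subrr expr0n mul0r.
have := IHp y; set b := f y - _; set S := path_energy _ _ _; set k := size p.
have -> : f x - f (last y p) = (f x - f y) + b by rewrite /b; ring.
set a := f x - f y; rewrite -natr1 => leb.
have [k0|k_gt0] := posnP k.
  have b0 : b = 0.
    by apply/eqP; rewrite -sqrf_eq0 eq_le sqr_ge0 andbT; rewrite k0 mul0r in leb.
  rewrite b0 k0 add0r addr0 mul1r lerDl.
  by apply: path_energy_ge0.
have kR_gt0 : 0 < k%:R :> R by rewrite ltr0n.
(* With a = f x - f y, multiplying the goal by k leaves (k a - b)^2 >= 0, up to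
   k + 1 times the induction hypothesis. *)
rewrite -(ler_pM2l kR_gt0).
by have := sqr_ge0 (k%:R * a - b); move: leb; nra.
Qed.

(** Prepending [x] to [y :: p] adds to the double sum the nonnegative terms with
    [x] in one of the two new positions, among them those of [(x, y)] and
    [(y, x)], which pay for the new step. *)
Lemma path_energy_le G f x p : path G x p ->
  2 * path_energy f x p <=
    \sum_(u <- x :: p) \sum_(v <- x :: p) (G u v)%:R * (f u - f v) ^+ 2.
Proof.
have g_ge0 u v : 0 <= (G u v)%:R * (f u - f v) ^+ 2.
  by rewrite mulr_ge0 ?ler0n ?sqr_ge0.
elim: p x => [|y p IHp] x /=.
  by rewrite mulr0 => _; do 2!apply: sumr_ge0 => ? _.
case/andP=> xy /IHp; set S := path_energy _ _ _; set q := y :: p => IH.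
rewrite big_cons [X in _ <= X + _]big_cons.
under [X in _ <= _ + X]eq_bigr => u _ do rewrite big_cons.
rewrite big_split /= -/q.
have le1 : (f x - f y) ^+ 2 <= \sum_(v <- q) (G x v)%:R * (f x - f v) ^+ 2.
  by rewrite big_cons xy mul1r lerDl sumr_ge0.
have le2 : (f x - f y) ^+ 2 <= \sum_(u <- q) (G u x)%:R * (f u - f x) ^+ 2.
  by rewrite big_cons adj_sym xy mul1r -sqrrN opprB lerDl sumr_ge0.
have := g_ge0 x x; move: le1 le2 IH; lra.
Qed.

(** The nodes of a shortest path are distinct, so the pairs of its nodes are
    among the pairs counted by the energy. *)
Lemma sqr_dist_le G f l x y : ele (dist G x y) l ->
  2 * (f x - f y) ^+ 2 <= l%:R * energy G f.
Proof.
have g_ge0 u v : 0 <= (G u v)%:R * (f u - f v) ^+ 2.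
  by rewrite mulr_ge0 ?ler0n ?sqr_ge0.
rewrite /dist; case E : (ohead _) => [k|//] /= kl.
have : k \in [seq k <- iota 0 #|T| | has_path G x y k].
  by case: [seq _ <- _ | _] E => //= k' ? [->]; rewrite mem_head.
rewrite mem_filter => /andP[/existsP[p /and3P[xp /eqP <- p_uniq]] _].
have sum_le (s : seq T) (F : T -> R) : uniq s -> (forall u, 0 <= F u) ->
    \sum_(u <- s) F u <= \sum_u F u.
  move=> s_uniq F_ge0; rewrite big_uniq //= [leRHS](bigID (mem s)) /=.
  by rewrite lerDl sumr_ge0.
have leE : 2 * path_energy f x p <= energy G f.
  apply: le_trans (path_energy_le f xp) _.
  apply: le_trans (sum_le _ _ p_uniq _) _; first by move=> u; apply: sumr_ge0.
  by apply: ler_sum => u _; apply: sum_le.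
have := sqr_path_le f x p; rewrite size_tuple => le_path.
apply: (le_trans (y := k%:R * energy G f)); last first.
  by rewrite ler_wpM2r ?energy_ge0 // ler_nat.
apply: (le_trans (y := k%:R * (2 * path_energy f x p))).
  by rewrite [leRHS]mulrCA ler_wpM2l.
by rewrite ler_wpM2l.
Qed.

(** A pair of nodes adjacent in [G] contributes the same to both energies, and
    each other pair adjacent in the power contributes at most
    [l * energy G f / 2], by [sqr_dist_le]. *)
Lemma energy_power_le G f l : (1 <= l)%N ->
  energy (power G l) f <=
    energy G f * (1 + l%:R * (#|edges (power G l)|%:R - #|edges G|%:R)).
Proof.
move=> l_ge1; set E := energy G f; pose c := l%:R * E / 2.
have -> : E * (1 + l%:R * (#|edges (power G l)|%:R - #|edges G|%:R)) =
    \sum_u \sum_v ((G u v)%:R * (f u - f v) ^+ 2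
                   + ((power G l u v)%:R - (G u v)%:R) * c).
  under eq_bigr => u _ do rewrite big_split /= -mulr_suml sumrB.
  rewrite big_split /= -/(energy G f) -/E -mulr_suml sumrB (sum_adj G).
  by rewrite (sum_adj (power G l)) /c; field.
apply: ler_sum => u _; apply: ler_sum => v _.
have [Guv|NGuv] := boolP (G u v); first by rewrite adj_power // subrr mul0r addr0.
rewrite mul0r add0r subr0.
have [/andP[_ uv]|_] := boolP (power G l u v); last by rewrite !mul0r.
by rewrite !mul1r /c ler_pdivlMr ?ltr0n // mulrC sqr_dist_le.
Qed.

Lemma sum_weighted_sqr_diff (a f : T -> R) :
  \sum_u \sum_v a u * a v * (f u - f v) ^+ 2 =
    2 * (\sum_u a u) * (\sum_u a u * f u ^+ 2) - 2 * (\sum_u a u * f u) ^+ 2.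
Proof.
set A := \sum_u a u; set B := \sum_u a u * f u; set C := \sum_u a u * f u ^+ 2.
have inner u : \sum_v a u * a v * (f u - f v) ^+ 2 =
    a u * f u ^+ 2 * A + a u * C - a u * f u * (2 * B).
  rewrite /A /B /C !mulr_sumr -big_split -sumrB /=.
  by apply: eq_bigr => v _; ring.
under eq_bigr => u _ do rewrite inner.
by rewrite sumrB big_split /= -!mulr_suml -/A -/B -/C; ring.
Qed.

(** With [a] the indicator of the complement of [S], the weight [1 - a u * a v]
    selects the pairs that meet [S], all of which are adjacent in [H]. Both parts
    of the weighted sum are evaluated by [sum_weighted_sqr_diff]. *)
Lemma energy_dominating_ge (S : {set T}) H f :
    {in S, forall u v, u != v -> H u v} -> \sum_u f u = 0 ->
  2 * #|S|%:R * (\sum_u f u ^+ 2) <= energy H f.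
Proof.
move=> domS f_sum0; pose a u : R := (u \notin S)%:R.
have le_a : \sum_u \sum_v (1 - a u * a v) * (f u - f v) ^+ 2 <= energy H f.
  apply: ler_sum => u _; apply: ler_sum => v _.
  have [->|uNv] := eqVneq u v; first by rewrite subrr expr0n !mulr0.
  rewrite ler_wpM2r ?sqr_ge0 // /a.
  have [uS|_] := boolP (u \in S).
    by rewrite domS // mul0r subr0.
  have [vS|_] := boolP (v \in S).
    by rewrite adj_sym domS 1?eq_sym // mulr0 subr0.
  by rewrite mulr1 subrr ler0n.
apply: le_trans le_a; set Q := \sum_u f u ^+ 2.
have -> : \sum_u \sum_v (1 - a u * a v) * (f u - f v) ^+ 2 =
    \sum_u \sum_v 1 * 1 * (f u - f v) ^+ 2
    - \sum_u \sum_v a u * a v * (f u - f v) ^+ 2.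
  rewrite -sumrB; apply: eq_bigr => u _; rewrite -sumrB.
  by apply: eq_bigr => v _; ring.
rewrite (sum_weighted_sqr_diff (fun=> 1)) sum_weighted_sqr_diff.
have aE : \sum_u a u = #|T|%:R - #|S|%:R.
  rewrite -(cardsC S) natrD addrC addKr -sum1_card natr_sum [RHS]big_mkcond /=.
  by apply: eq_bigr => u _; rewrite /a inE; case: (u \in S).
have leQ : \sum_u a u * f u ^+ 2 <= Q.
  apply: ler_sum => u _; rewrite /a; case: (u \notin S); first by rewrite mul1r.
  by rewrite mul0r sqr_ge0.
have f1 : \sum_u 1 * f u = 0 by rewrite -mulr_sumr f_sum0 mulr0.
have Q1 : \sum_u 1 * f u ^+ 2 = Q by rewrite -mulr_sumr mul1r.
have T1 : \sum_(u : T) 1 = #|T|%:R :> R by rewrite sumr_const.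
rewrite f1 Q1 T1 aE.
have A_ge0 : 0 <= #|T|%:R - #|S|%:R :> R by rewrite subr_ge0 ler_nat max_card.
have := ler_wpM2l A_ge0 leQ; have := sqr_ge0 (\sum_u a u * f u).
by lra.
Qed.

End Energy.

(** * The Laplacian *)

Section Laplacian.
Variables (R : rcfType) (T : finType).
Implicit Types G : sgraph T.

Lemma quadratic_form_laplacian G (v : 'rV[R]_#|T|) :
  2 * (v *m laplacian R G *m v^T) 0 0 = energy G (fun u => v 0 (enum_rank u)).
Proof.
have sumT (F : T -> R) : \sum_u F u = \sum_(i < #|T|) F (enum_val i).
  by rewrite (reindex (@enum_val T T)) //; apply/onW_bij/enum_val_bij.
have -> : energy G (fun u => v 0 (enum_rank u)) =
    \sum_i \sum_j adjmx R G i j * (v 0 i - v 0 j) ^+ 2.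
  rewrite /energy sumT; apply: eq_bigr => i _; rewrite sumT; apply: eq_bigr => j _.
  by rewrite !mxE !enum_valK.
pose A := adjmx R G; pose deg i := \sum_j A i j.
have Asym i j : A i j = A j i by rewrite !mxE adj_sym.
have vLE j : (v *m laplacian R G) 0 j = v 0 j * deg j - \sum_i v 0 i * A i j.
  rewrite /laplacian /degmx mulmxBr mul_mx_diag !mxE.
  by congr (_ - _); apply: eq_bigr => i _; rewrite !mxE.
have -> : (v *m laplacian R G *m v^T) 0 0 =
    \sum_j \sum_i A i j * (v 0 j ^+ 2 - v 0 i * v 0 j).
  rewrite mxE; apply: eq_bigr => j _; rewrite vLE mxE mulrBl mulr_suml /deg.
  rewrite mulr_sumr mulr_suml -sumrB; apply: eq_bigr => i _.
  by rewrite [A j i]Asym; ring.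
rewrite mulr_natl mulr2n {1}exchange_big -big_split; apply: eq_bigr => i _ /=.
rewrite -big_split; apply: eq_bigr => j _ /=; rewrite -/A [A j i]Asym; ring.
Qed.

Lemma laplacian_tr G : (laplacian R G)^T = laplacian R G.
Proof.
rewrite /laplacian linearB /= tr_diag_mx; congr (_ - _).
by apply/matrixP=> i j; rewrite !mxE adj_sym.
Qed.

Lemma laplacian_const G : laplacian R G *m const_mx 1 = 0 :> 'cV_#|T|.
Proof.
apply/colP=> i; rewrite mulmxBl mul_diag_mx !mxE mulr1.
by apply/eqP; rewrite subr_eq0; apply/eqP; apply: eq_bigr => j _; rewrite !mxE mulr1.
Qed.

(** The function [f] is an eigenvector of the Laplacian for [lambda_2], orthogonal
    to the constants, read as a function on the nodes. *)
Lemma algebraic_connectivity_eigenfunction G : (2 <= #|T|)%N ->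
  exists f : T -> R, [/\ \sum_u f u = 0, 0 < \sum_u f u ^+ 2 &
    energy G f = 2 * (algebraic_connectivity R G * \sum_u f u ^+ 2)].
Proof.
move=> T_ge2; have [|||v v_neq0 [vL v_sum0]] := @second_eigenvector R _ (laplacian R G) T_ge2.
- exact: laplacian_tr.
- by move=> v; rewrite -(pmulr_rge0 _ (ltr0n R 2)) quadratic_form_laplacian energy_ge0.
- exact: laplacian_const.
rewrite -/(algebraic_connectivity R G) in vL.
have sumT (F : 'I_#|T| -> R) : \sum_i F i = \sum_u F (enum_rank u).
  by rewrite (reindex (@enum_rank T)) //; apply/onW_bij/enum_rank_bij.
exists (fun u => v 0 (enum_rank u)); split.
- have /rowP/(_ 0) := v_sum0; rewrite !mxE sumT => E0; rewrite -[RHS]E0.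
  by apply: eq_bigr => u _; rewrite mxE mulr1.
- rewrite lt_neqAle sumr_ge0 ?andbT => [|u _]; last exact: sqr_ge0.
  apply: contra_neq v_neq0 => /esym/eqP.
  rewrite psumr_eq0 => [|u _]; last exact: sqr_ge0.
  move/allP=> f0; apply/rowP => i; have := f0 (enum_val i).
  by rewrite mem_index_enum => /(_ isT) /=; rewrite sqrf_eq0 enum_valK mxE => /eqP.
rewrite -quadratic_form_laplacian vL -scalemxAl mxE; congr (_ * (_ * _)).
by rewrite mxE sumT; apply: eq_bigr => u _; rewrite mxE -expr2.
Qed.

End Laplacian.

(** * The lower bound *)

Theorem mainTheorem3 (R : rcfType) (T : finType) (G : sgraph T) (n m l : nat)
    (hT : #|T| = n) (hn : (2 <= n)%N) (hm : #|edges G| = m) (hl : (1 <= l)%N) :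
  algebraic_connectivity R G >=
    (num_ecc_le G l)%:R / (1 + l%:R * (#|edges (power G l)|%:R - m%:R)).
Proof.
have [|f [f_sum0 Q_gt0 energyE]] := @algebraic_connectivity_eigenfunction R T G.
  by rewrite hT.
set D := 1 + _; have D_gt0 : 0 < D.
  rewrite /D -hm; apply: (lt_le_trans ltr01); rewrite lerDl mulr_ge0 //.
  by rewrite subr_ge0 ler_nat card_edges_power.
rewrite ler_pdivrMr // -(ler_pM2r Q_gt0) -(ler_pM2l (ltr0n R 2)).
have -> : 2 * (algebraic_connectivity R G * D * (\sum_u f u ^+ 2)) = energy G f * D.
  by rewrite energyE; ring.
apply: le_trans (_ : energy (power G l) f <= _); last by rewrite /D -hm energy_power_le.
rewrite mulrA; apply: energy_dominating_ge => // u; rewrite inE => u_ecc w uNw.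
by rewrite /= /power_adj uNw ele_ecc.
Qed.
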